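(* Let $(\Sigma,F)$ be a Finsler surface (an orientable smooth $2$-manifold with a Finsler metric), let $f\colon\Sigma\to\mathbb{R}$ be a $C^\infty$ function, and let $F_f=e^{f}F$. Then the Finsler--Laplace operators satisfy $$\Delta^{F_f}=e^{-2f}\,\Delta^F.$$
   Context: A Finsler metric on an $n$-manifold $M$ is a continuous function $F\colon TM\to[0,\infty)$ that is $C^\infty$ off the zero section, satisfies $F(x,\lambda v)=\lambda F(x,v)$ for $\lambda>0$, satisfies $F(x,v)\ge 0$ with equality iff $v=0$, and is strongly convex: $\left(\frac{\partial^2F^2}{\partial v_i\partial v_j}\right)_{i,j}$ is positive definite (off the zero section). $F$ is not assumed reversible. Let $HM=(TM\smallsetminus\{0\})/\mathbb{R}^+_*$ be the homogenized tangent bundle, $r\colon TM\smallsetminus\{0\}\to HM$ and $\pi\colon HM\to M$ the projections, $H_xM=\pi^{-1}(x)$, $VHM=\ker d\pi$. The Hilbert form $A$ of $F$ is the $1$-form on $HM$ given by $A_{(x,\xi)}(Z)=\lim_{\epsilon\to0}\frac{1}{\epsilon}\left(F(x,v+\epsilon\, d\pi(Z))-F(x,v)\right)$ for any $v\in T_xM$ with $r(x,v)=(x,\xi)$. It is a contact form and its Reeb field $X$ ($A(X)=1$, $i_XdA=0$) generates the geodesic flow of $F$ on $HM$. There is a unique volume form $\Omega^F$ on $M$, and an $(n-1)$-form $\alpha^F$ on $HM$, nowhere zero on $VHM$ and whose restriction to $VHM$ is unique, such that $\alpha^F\wedge\pi^*\Omega^F=A\wedge dA^{n-1}$ and $\int_{H_xM}\alpha^F=\mathrm{vol}_{\mathrm{Eucl}}(\mathbb{S}^{n-1})$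 for all $x\in M$ (orientations being chosen compatibly). The Finsler--Laplace operator is $$\Delta^Ff(x)=\frac{n}{\mathrm{vol}_{\mathrm{Eucl}}(\mathbb{S}^{n-1})}\int_{H_xM}L_X^2(\pi^*f)\,\alpha^F ,$$ where $L_X$ is the Lie derivative. Here $n=2$. *)

(* Defs.v *)
From HB Require Import structures.
From mathcomp Require Import all_boot all_order all_algebra.
From mathcomp Require Import all_classical all_reals all_analysis.
Import Order.TTheory GRing.Theory Num.Theory.
Import numFieldNormedType.Exports.

Set Implicit Arguments.
Unset Strict Implicit.
Unset Printing Implicit Defensive.

Local Open Scope classical_set_scope.
Local Open Scope ring_scope.

Section Smooth.
Context {R : realType} {V W : normedModType R}.

Fixpoint iter_derive (vs : seq V) (f : V -> W) : V -> W :=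
  if vs is v :: vs' then iter_derive vs' ('D_v f) else f.

(* For V finite dimensional and U open this is the class C^oo on U: every
   iterated directional derivative is (Frechet) differentiable on U. *)
Definition smooth_on (U : set V) (f : V -> W) : Prop :=
  forall vs x, U x -> differentiable (iter_derive vs f) x.

End Smooth.

Section Surface.
Context {R : realType}.

(* Smooth 2-manifolds, Hausdorff and second countable, given by an atlas.
   [chart_inv i] is only meaningful on the image of [chart i]. *)
Record surface := Surface {
  carrier :> topologicalType;
  chart_index : Type;
  dom : chart_index -> set carrier;
  chart : chart_index -> carrier -> 'rV[R]_2;
  chart_inv : chart_index -> 'rV[R]_2 -> carrier;
  surface_hausdorff : hausdorff_space carrier;
  surface_second_countable : @second_countable carrier;
  dom_open : forall i, open (dom i);
  dom_cover : forall x, exists i, dom i x;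
  chart_open : forall i, open (chart i @` dom i);
  chartK : forall i x, dom i x -> chart_inv i (chart i x) = x;
  chart_continuous : forall i x, dom i x -> {for x, continuous (chart i)};
  chart_inv_continuous : forall i y, (chart i @` dom i) y ->
    {for y, continuous (chart_inv i)};
  transition_smooth : forall i j,
    smooth_on (chart i @` (dom i `&` dom j)) (chart j \o chart_inv i)
}.

Definition img (M : surface) (i : chart_index M) : set 'rV[R]_2 :=
  chart i @` dom i.

Definition transition (M : surface) (i j : chart_index M) :
  'rV[R]_2 -> 'rV[R]_2 := chart j \o chart_inv i.

Definition smooth (M : surface) (f : M -> R) : Prop :=
  forall i : chart_index M, smooth_on (img i) (f \o chart_inv i).

Definition area (u w : 'rV[R]_2) : R := u 0 0 * w 0 1 - u 0 1 * w 0 0.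

(* The 2-form equal to [omega i y * (dy_1 /\ dy_2)] in each chart. *)
Definition volume_form (M : surface)
    (omega : chart_index M -> 'rV[R]_2 -> R) : Prop :=
  [/\ forall i, smooth_on (img i) (omega i),
      forall i y, img i y -> omega i y != 0 &
      forall i j x, dom i x -> dom j x -> forall u w,
        omega i (chart i x) * area u w =
        omega j (chart j x) * area ('d (transition i j) (chart i x) u)
                                   ('d (transition i j) (chart i x) w)].

Definition orientable (M : surface) : Prop := exists omega, @volume_form M omega.

End Surface.
Arguments surface R : clear implicits.

Section Tangent.
Context {R : realType} {M : surface R}.
Implicit Types (i j k : chart_index M) (x : M).

Lemma transition_near i j x : dom i x -> dom j x ->
  \forall y \near chart i x, img i y /\ dom j (chart_inv i y).
Proof.
move=> ix jx; have iy : (chart i @` dom i) (chart i x) by exists x.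
near=> y; split; near: y.
  by apply: open_nbhs_nbhs; split; [exact: chart_open | exact: iy].
apply: (chart_inv_continuous iy); rewrite chartK//.
by apply: open_nbhs_nbhs; split; [exact: dom_open|].
Unshelve. all: by end_near. Qed.

Lemma transition_differentiable i j x : dom i x -> dom j x ->
  differentiable (transition i j) (chart i x).
Proof.
by move=> ix jx; apply: (@transition_smooth _ M i j [::]); exists x.
Qed.

Lemma transition_cocycle i j k x v : dom i x -> dom j x -> dom k x ->
  'd (transition i k) (chart i x) v =
  'd (transition j k) (chart j x) ('d (transition i j) (chart i x) v).
Proof.
move=> ix jx kx.
have tij : transition i j (chart i x) = chart j x.
  by rewrite /transition /= chartK.
have dij := transition_differentiable ix jx.
have djk : differentiable (transition j k) (transition i j (chart i x)).
  by rewrite tij; exact: transition_differentiable.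
have dik := transition_differentiable ix kx.
have chain : 'd (transition j k \o transition i j) (chart i x) v =
    'd (transition j k) (chart j x) ('d (transition i j) (chart i x) v).
  have e := diff_comp dij djk.
  move/(congr1 (fun h => h v)): e => e.
  by rewrite -tij; exact: e.
have dc : differentiable (transition j k \o transition i j) (chart i x).
  exact: differentiable_comp dij djk.
apply: etrans chain; apply: etrans (deriveE v dc).
apply: etrans (esym (deriveE v dik)) _.
apply: near_eq_derive.
near=> y.
have [_ jy] : img i y /\ dom j (chart_inv i y).
  by near: y; exact: transition_near.
by rewrite [RHS]/comp /transition [RHS]/comp [in RHS]/comp chartK.
Unshelve. all: by end_near. Qed.

Record tangent x := Tangent {
  tcoord : chart_index M -> 'rV[R]_2;
  tcoord_dom : forall i, ~ dom i x -> tcoord i = 0;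
  tcoord_transition : forall i j, dom i x -> dom j x ->
    tcoord j = 'd (transition i j) (chart i x) (tcoord i)
}.

Fact tzero_transition x i j : dom i x -> dom j x ->
  0 = 'd (transition i j) (chart i x) 0.
Proof. by rewrite linear0. Qed.

Definition tzero x : tangent x :=
  Tangent (fun i (_ : ~ dom i x) => erefl) (@tzero_transition x).

Fact tscale_dom x (l : R) (v : tangent x) i : ~ dom i x -> l *: tcoord v i = 0.
Proof. by move=> xi; rewrite tcoord_dom// scaler0. Qed.

Fact tscale_transition x (l : R) (v : tangent x) i j : dom i x -> dom j x ->
  l *: tcoord v j = 'd (transition i j) (chart i x) (l *: tcoord v i).
Proof. by move=> xi xj; rewrite linearZ (tcoord_transition v xi xj). Qed.

Definition tscale x (l : R) (v : tangent x) : tangent x :=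
  Tangent (@tscale_dom x l v) (@tscale_transition x l v).

(* The vector at x with coordinates v in the chart i (0 if x is not in
   [dom i]). *)
Definition chart_tcoord i x (v : 'rV[R]_2) j : 'rV[R]_2 :=
  if `[< dom i x /\ dom j x >] then 'd (transition i j) (chart i x) v else 0.

Fact chart_tcoord_dom i x v j : ~ dom j x -> chart_tcoord i x v j = 0.
Proof. by move=> xj; rewrite /chart_tcoord asboolF// => -[]. Qed.

Fact chart_tcoord_transition i x v j k : dom j x -> dom k x ->
  chart_tcoord i x v k = 'd (transition j k) (chart j x) (chart_tcoord i x v j).
Proof.
move=> xj xk; rewrite /chart_tcoord; have [xi|xi] := pselect (dom i x).
  by rewrite !asboolT//; exact: transition_cocycle.
by rewrite !asboolF ?linear0// => -[].
Qed.

Definition chart_tangent i x (v : 'rV[R]_2) : tangent x :=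
  Tangent (@chart_tcoord_dom i x v) (@chart_tcoord_transition i x v).

(* Points of HM: a ray is an equivalence class of non-zero tangent vectors
   under positive scaling. *)
Record homog := Homog {
  hpoint : M;
  hray : set (tangent hpoint);
  hray_class : exists2 v, v <> tzero hpoint &
    hray = [set w | exists2 l, 0 < l & w = tscale l v]
}.

End Tangent.
Arguments tangent {R} M x.
Arguments homog {R} M.
Arguments hray {R M} z : rename.

Section Finsler.
Context {R : realType} {M : surface R}.
Implicit Types (F : forall x : M, tangent M x -> R) (i j : chart_index M).

Definition finsler_chart F i (y v : 'rV[R]_2) : R :=
  F (chart_inv i y) (chart_tangent i (chart_inv i y) v).

Definition hessian (h : 'rV[R]_2 -> R) (v : 'rV[R]_2) : 'M[R]_2 :=
  \matrix_(a, b) 'D_(delta_mx 0 a) ('D_(delta_mx 0 b) h) v.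

Definition positive_definite (H : 'M[R]_2) : Prop :=
  forall w : 'rV[R]_2, w != 0 -> 0 < (w *m H *m w^T) 0 0.

Record finsler_metric F : Prop := FinslerMetric {
  finsler_ge0 : forall x v, 0 <= F x v;
  finsler_eq0 : forall x v, F x v = 0 <-> v = tzero x;
  finsler_homogeneous : forall x v l, 0 < l -> F x (tscale l v) = l * F x v;
  finsler_continuous : forall i (p : 'rV[R]_2 * 'rV[R]_2), img i p.1 ->
    {for p, continuous (fun q => finsler_chart F i q.1 q.2)};
  finsler_smooth : forall i,
    smooth_on [set p : 'rV[R]_2 * 'rV[R]_2 | img i p.1 /\ p.2 != 0]
      (fun q => finsler_chart F i q.1 q.2);
  finsler_convex : forall i y v, img i y -> v != 0 ->
    positive_definite (hessian (fun u => finsler_chart F i y u ^+ 2) v)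
}.

Definition conformal (f : M -> R) F : forall x : M, tangent M x -> R :=
  fun x v => expR (f x) * F x v.

(* Over [dom i], HM is parametrized by (y, t) in [img i] x R, where (y, t)
   stands for the ray through the vector with coordinates (cos t, sin t) at the
   point with coordinates y.  This is a local diffeomorphism, 2pi-periodic in t,
   in which the projection to M is (y, t) |-> y and VHM is spanned by d/dt. *)
Definition hmspace := ('rV[R]_2 * R)%type.

Definition dir (t : R) : 'rV[R]_2 :=
  \row_k (if k == 0 then cos t else sin t).

Definition hdom i : set hmspace := [set p | img i p.1].

Definition hcoord i (p : hmspace) (z : homog M) : Prop :=
  [/\ dom i (hpoint z), chart i (hpoint z) = p.1 &
      hray z (chart_tangent i (hpoint z) (dir p.2))].

Definition hm_change i j (T : hmspace -> hmspace) (p : hmspace) : Prop :=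
  [/\ hdom i p, differentiable T p &
      \forall q \near p, forall z, hcoord i q z -> hcoord j (T q) z].

(* Tensor fields on HM are families of local expressions in the coordinates
   (y, t), matching under every change of coordinates. *)
Definition hm_vector_field (X : chart_index M -> hmspace -> hmspace) : Prop :=
  (forall i, smooth_on (hdom i) (X i)) /\
  (forall i j T p, hm_change i j T p -> X j (T p) = 'd T p (X i p)).

Definition hm_one_form (a : chart_index M -> hmspace -> hmspace -> R) : Prop :=
  [/\ forall i p, hdom i p -> forall k Z W,
        a i p (k *: Z + W) = k * a i p Z + a i p W,
      forall i Z, smooth_on (hdom i) (fun p => a i p Z) &
      forall i j T p, hm_change i j T p -> forall Z,
        a i p Z = a j (T p) ('d T p Z)].

Definition ext_deriv (a : hmspace -> hmspace -> R) (p Z W : hmspace) : R :=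
  'D_Z (fun q => a q W) p - 'D_W (fun q => a q Z) p.

Definition wedge12 (a : hmspace -> R) (b : hmspace -> hmspace -> R)
    (Z1 Z2 Z3 : hmspace) : R :=
  a Z1 * b Z2 Z3 - a Z2 * b Z1 Z3 + a Z3 * b Z1 Z2.

Definition lie (X : hmspace -> hmspace) (h : hmspace -> R) : hmspace -> R :=
  fun p => 'D_(X p) h p.

Definition hilbert_form F i (p Z : hmspace) : R :=
  'D_(Z.1) (finsler_chart F i p.1) (dir p.2).

Definition reeb_field F (X : chart_index M -> hmspace -> hmspace) : Prop :=
  hm_vector_field X /\
  forall i p, hdom i p ->
    hilbert_form F i p (X i p) = 1 /\
    forall Z, ext_deriv (hilbert_form F i) p (X i p) Z = 0.

Definition d_dt : hmspace := (0, 1).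

(* The integral of [h * a] over the fibre above the point of coordinates y, for
   the orientation of the fibre which makes the 1-form a (non-zero along the
   fibres) positive; it is the only orientation for which a itself can have
   positive integral. *)
Definition fibre_integral (h : hmspace -> R) (a : hmspace -> hmspace -> R)
    (y : 'rV[R]_2) : R :=
  \int[lebesgue_measure]_(t in `[0, 2 * pi]) (h (y, t) * `|a (y, t) d_dt|).

Definition vol_S1 : R := 2 * pi.

Definition angle_volume F (alpha : chart_index M -> hmspace -> hmspace -> R)
    (omega : chart_index M -> 'rV[R]_2 -> R) : Prop :=
  [/\ volume_form omega,
      hm_one_form alpha,
      forall i p, hdom i p -> forall Z : hmspace,
        Z.1 = 0 -> Z != 0 -> alpha i p Z != 0,
      forall i p, hdom i p -> forall Z1 Z2 Z3,
        wedge12 (alpha i p) (fun Z W => omega i p.1 * area Z.1 W.1) Z1 Z2 Z3 =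
        wedge12 (hilbert_form F i p) (ext_deriv (hilbert_form F i) p) Z1 Z2 Z3 &
      forall i y, img i y -> fibre_integral (fun=> 1) (alpha i) y = vol_S1].

(* X, omega and the restriction of alpha to the fibres are unique (omega and
   alpha up to a simultaneous change of sign on components of M, which does not
   affect the fibre integral), so that this determines D on smooth functions. *)
Definition finsler_laplacian F (D : (M -> R) -> M -> R) : Prop :=
  exists X alpha omega,
    [/\ reeb_field F X, angle_volume F alpha omega &
        forall g, smooth g -> forall i x, dom i x ->
          D g x = 2 / vol_S1 *
            fibre_integral
              (lie (X i) (lie (X i) (fun p => g (chart_inv i p.1))))
              (alpha i) (chart i x)].

End Finsler.

(* Main.v *)
(** Write [b] for the Hilbert form, [m] for [alpha(d/dt)] and
    [D = b_2 d_t b_1 - b_1 d_t b_2] for the coefficient of [b /\ db], so that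
    [m * omega = D]. Scaling [F] by [e^f] scales [b] by [e^f], hence [D] by
    [e^(2f)], a function of the base point; by the normalisation of the angle
    form, [|m|] is therefore unchanged on every fibre. The Reeb equations and
    [D <> 0] give [X' = e^(-f) (X + u d/dt)] where [u d_t b_k = d_k f - b_k (X f)],
    hence, with [h = X g],
    [X' (X' g) = e^(-2f) (X (X g) + u d_t h - h (X f))].
    The correction term integrates to zero on the fibre because, multiplied by
    [D], it is the [t]-derivative of [(f_1 b_2 - f_2 b_1) h], which is
    [2 pi]-periodic. *)
Require Import Defs.
From mathcomp Require Import all_boot all_order all_algebra.
From mathcomp Require Import all_classical all_reals all_analysis.
From mathcomp Require Import ring lra.
Import Order.TTheory GRing.Theory Num.Theory.
Import numFieldNormedType.Exports.

Set Implicit Arguments.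
Unset Strict Implicit.
Unset Printing Implicit Defensive.

Local Open Scope classical_set_scope.
Local Open Scope ring_scope.

(** * Directional derivatives and differentiability *)

Section DirectionalDerivative.
Context {R : realType}.

Lemma derive_dirP (V W : normedModType R) (f : V -> W) (x : V) k u v :
  differentiable f x -> 'D_(k *: u + v) f x = k *: 'D_u f x + 'D_v f x.
Proof. by move=> df; rewrite !deriveE// linearP. Qed.

Lemma derive_fst (V W : normedModType R) (f : V -> R) (p Z : (V * W)%type) :
  'D_Z (fun q => f q.1) p = 'D_(Z.1) f p.1.
Proof. by []. Qed.

(** Turns a derivative along the fibre into one of a function of both variables, to which joint
    smoothness applies. *)
Lemma derive_snd (V W N : normedModType R) (f : V -> W -> N) y v w :
  'D_w (f y) v = 'D_(0, w) (fun q => f q.1 q.2) (y, v).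
Proof.
rewrite /derive; apply: (congr1 (fun g => lim (g @ 0^'))); apply/funext => h /=.
by rewrite scaler0 add0r.
Qed.

Lemma derive_expR_comp (V : normedModType R) (f : V -> R) x v :
  differentiable f x ->
  'D_v (fun y => expR (f y)) x = expR (f x) * 'D_v f x.
Proof.
move=> df.
have de : differentiable expR (f x).
  by apply/derivable1_diffP; exact: derivable_expR.
rewrite (@deriveE _ _ _ (expR \o f)); last exact: differentiable_comp.
rewrite diff_comp//= -(deriveE v df).
rewrite -[in LHS](mulr1 ('D_v f x)) [LHS]linearZ_LR -(deriveE _ de) mulrC.
by congr (_ * _); exact: (@derive_val _ _ _ _ _ _ _ (is_derive_expR (f x))).
Qed.

Lemma differentiable_expR (V : normedModType R) (f : V -> R) x :
  differentiable f x -> differentiable (fun y => expR (f y)) x.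
Proof.
move=> df; apply: (@differentiable_comp _ _ _ _ f expR) => //.
by apply/derivable1_diffP; exact: derivable_expR.
Qed.

Lemma differentiable_fst (V W : normedModType R) (p : (V * W)%type) :
  differentiable fst p.
Proof. by apply: linear_differentiable => q; exact: cvg_fst. Qed.

Lemma differentiable_comp_fst (V W N : normedModType R) (f : V -> N)
    (p : (V * W)%type) :
  differentiable f p.1 -> differentiable (fun q => f q.1) p.
Proof. by move=> df; apply: differentiable_comp => //; exact: differentiable_fst. Qed.

End DirectionalDerivative.

Lemma near_eq_differentiable (R : realType) (V W : normedModType R)
    (f g : V -> W) (x : V) :
  (\forall y \near x, f y = g y) -> differentiable f x -> differentiable g x.
Proof.
move=> fg [[cf /eqaddoP fE]].
apply/diffP.
(* The differential is defined by choice, so a continuous linear map meeting its specification for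
   [g] must be exhibited; ['d f x] serves. *)
apply: (@getPex _ (fun df : {linear V -> W} => continuous df /\
  forall y, g y = g (lim (nbhs x)) + df (y - lim (nbhs x))
                  +o_(y \near x) (y - lim (nbhs x)))).
exists ('d f x); split => //.
have gx : g x = f x by rewrite (nbhs_singleton fg).
suff : g = cst (g (lim (nbhs x))) + 'd f x \o center (lim (nbhs x))
           +o_x (center (lim (nbhs x))) by rewrite funeqE.
apply/eqaddoP => e e0; move: (fE e e0); apply: filterS2 fg => y fgy.
by rewrite !fctE /= -fgy !lim_id// gx.
Qed.

(** * Semibasic forms and the Reeb equations in the coordinates (y, t) *)

Section Semibasic.
Context {R : realType}.
Local Notation hmspace := (@hmspace R).
Implicit Types (U : set 'rV[R]_2) (p q Z W : hmspace).

Definition basis_vec (k : 'I_2) : hmspace := (delta_mx 0 k, 0).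

Lemma rV2_sum (u : 'rV[R]_2) :
  u = u 0 0 *: delta_mx 0 0 + u 0 1 *: delta_mx 0 1.
Proof.
apply/rowP => k; rewrite !mxE /=.
case: k => -[|[|//]] ?; rewrite !(mulr0, mulr1, addr0, add0r)//.
  by congr (u _ _); apply/val_inj.
by congr (u _ _); apply/val_inj.
Qed.

Lemma hmspace_sum Z :
  Z = Z.1 0 0 *: basis_vec 0 + (Z.1 0 1 *: basis_vec 1 + Z.2 *: d_dt).
Proof.
case: Z => u s; rewrite /basis_vec /d_dt; congr pair => /=.
  by rewrite scaler0 addr0 -rV2_sum.
by rewrite !scaler0 !add0r; exact/esym/mulr1.
Qed.

(** Isolates what the local computation uses of the Hilbert form, so that it runs without mentioning
    [F]. *)
Definition semibasic U (b : hmspace -> hmspace -> R) : Prop :=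
  forall p, U p.1 ->
  [/\ forall k Z W, b p (k *: Z + W) = k * b p Z + b p W,
      forall Z, Z.1 = 0 -> b p Z = 0 &
      forall Z, differentiable (b ^~ Z) p].

Variable U : set 'rV[R]_2.
Hypothesis oU : open U.

Lemma near_fst p : U p.1 -> \forall q \near p, U q.1.
Proof.
move=> Up.
have : nbhs p.1 U by apply: open_nbhs_nbhs.
exact: cvg_fst.
Qed.

Section Form.
Variable b : hmspace -> hmspace -> R.
Hypothesis bU : semibasic U b.

Lemma semibasic_sum p Z : U p.1 ->
  b p Z = Z.1 0 0 * b p (basis_vec 0) + Z.1 0 1 * b p (basis_vec 1).
Proof.
move=> Up; have [lin ver _] := bU Up.
rewrite [in LHS](hmspace_sum Z) !lin -[Z.2 *: d_dt]addr0 lin.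
by rewrite !(ver d_dt)// (ver 0)// mulr0 !addr0.
Qed.

Lemma semibasic_derive_sum p Z W : U p.1 ->
  'D_W (b ^~ Z) p = Z.1 0 0 * 'D_W (b ^~ (basis_vec 0)) p
                  + Z.1 0 1 * 'D_W (b ^~ (basis_vec 1)) p.
Proof.
move=> Up; have [_ _ dif] := bU Up.
rewrite (@near_eq_derive _ _ _ _ (fun q =>
    Z.1 0 0 *: b q (basis_vec 0) + Z.1 0 1 *: b q (basis_vec 1))); last first.
  by apply: filterS (near_fst Up) => q Uq; exact: semibasic_sum.
rewrite deriveD; try (apply: derivableZ; exact: diff_derivable).
by rewrite !deriveZ//; exact: diff_derivable.
Qed.

Lemma derive_vertical p Z W : U p.1 -> Z.1 = 0 -> 'D_W (b ^~ Z) p = 0.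
Proof. by move=> Up Z0; rewrite semibasic_derive_sum// Z0 !mxE !mul0r addr0. Qed.

(* The coefficient of [b /\ db] on [d/dt, d/dy_1, d/dy_2]. *)
Definition contact_coef p : R :=
  b p (basis_vec 1) * 'D_d_dt (b ^~ (basis_vec 0)) p
  - b p (basis_vec 0) * 'D_d_dt (b ^~ (basis_vec 1)) p.

Lemma wedge12_ext_deriv p : U p.1 ->
  wedge12 (b p) (ext_deriv b p) d_dt (basis_vec 0) (basis_vec 1) = contact_coef p.
Proof.
move=> Up; have [_ ver _] := bU Up.
rewrite /wedge12 /ext_deriv /contact_coef (ver d_dt)// !(@derive_vertical p d_dt)//.
by rewrite mul0r !subr0 sub0r addrC.
Qed.

Definition reeb_at p Z : Prop :=
  b p Z = 1 /\ forall W, ext_deriv b p Z W = 0.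

(** Test the Reeb equation on [d_dt]: since [b] kills vertical vectors at all nearby points, one of
    the two terms of the exterior derivative vanishes. *)
Lemma reeb_at_derive_vertical p Z : U p.1 -> reeb_at p Z ->
  'D_d_dt (b ^~ Z) p = 0.
Proof.
move=> Up [_ /(_ d_dt)]; rewrite /ext_deriv derive_vertical// sub0r.
by move/eqP; rewrite oppr_eq0 => /eqP.
Qed.

(** Cramer's rule without division: [b(Z) = 1] and [d_t b(Z) = 0] form a linear system in the two
    base coordinates of [Z], with determinant [- contact_coef]. *)
Lemma reeb_at_coord p Z : U p.1 -> reeb_at p Z ->
  Z.1 0 0 * contact_coef p = - 'D_d_dt (b ^~ (basis_vec 1)) p /\
  Z.1 0 1 * contact_coef p = 'D_d_dt (b ^~ (basis_vec 0)) p.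
Proof.
move=> Up rZ; have := reeb_at_derive_vertical Up rZ; have [+ _] := rZ.
rewrite semibasic_sum// semibasic_derive_sum// /contact_coef.
set x := Z.1 0 0; set y := Z.1 0 1; set b0 := b _ _; set b1 := b _ _.
set c0 := 'D__ _ _; set c1 := 'D__ _ _ => e1 e2; split.
  by transitivity (b1 * (x * c0 + y * c1) - (x * b0 + y * b1) * c1);
    [ring | rewrite e1 e2; ring].
by transitivity ((x * b0 + y * b1) * c0 - b0 * (x * c0 + y * c1));
  [ring | rewrite e1 e2; ring].
Qed.
End Form.

(** * Conformal change of a semibasic form and of its Reeb vector *)

Section Conformal.
Variables (b b' : hmspace -> hmspace -> R) (phi : 'rV[R]_2 -> R).
Hypothesis bU : semibasic U b.
Hypothesis dphi : forall y, U y -> differentiable phi y.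
Hypothesis b'E : forall p Z, U p.1 -> b' p Z = expR (phi p.1) * b p Z.

Let E p : R := expR (phi p.1).

Let dE p : U p.1 -> differentiable E p.
Proof.
move=> Up; apply: (@differentiable_comp_fst _ _ _ _ (fun y => expR (phi y))).
exact/differentiable_expR/dphi.
Qed.

Let derive_E p W : U p.1 -> 'D_W E p = E p * 'D_(W.1) phi p.1.
Proof.
move=> Up; rewrite (@derive_fst _ _ _ (fun y => expR (phi y))).
by rewrite derive_expR_comp//; exact: dphi.
Qed.

Let near_b' Z p : U p.1 -> \forall q \near p, b' q Z = E q * b q Z.
Proof. by move=> Up; apply: filterS (near_fst Up) => q; exact: b'E. Qed.

Lemma semibasic_conformal : semibasic U b'.
Proof.
move=> p Up; have [lin ver dif] := bU Up; split.
- by move=> k Z W; rewrite !b'E// lin; ring.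
- by move=> Z Z0; rewrite b'E// ver// mulr0.
- move=> Z; apply: (@near_eq_differentiable _ _ _ (fun q => E q * b q Z)).
    by apply: filterS (near_b' Z Up) => q ->.
  by apply: differentiableM => //; exact: dE.
Qed.

Lemma derive_conformal p Z W : U p.1 ->
  'D_W (b' ^~ Z) p = E p * ('D_W (b ^~ Z) p + b p Z * 'D_(W.1) phi p.1).
Proof.
move=> Up; have [_ _ dif] := bU Up.
rewrite (near_eq_derive _ (near_b' Z Up)).
rewrite (@deriveM _ _ E (b ^~ Z)); try exact: diff_derivable;
  last exact/diff_derivable/dE.
by rewrite derive_E// mulrDr; congr (_ + _); exact: mulrCA.
Qed.

(** The extra Leibniz term contains the derivative of [phi] along the base part of [d_dt], which is
    0; each product of [b] and its derivative then picks up [E p] twice. *)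
Lemma contact_coef_conformal p : U p.1 ->
  contact_coef b' p = E p ^+ 2 * contact_coef b p.
Proof.
move=> Up; rewrite /contact_coef !derive_conformal// !b'E// !derive0.
by rewrite -/(E p); ring.
Qed.

(** By Cramer's rule the base parts of [E p *: Z'] and [Z] agree, so the two differ by a vertical
    vector. Comparing both Reeb equations on a test vector [W] gives the formula for [u]. *)
Lemma reeb_conformal p Z Z' : U p.1 -> contact_coef b p != 0 ->
  reeb_at b p Z -> reeb_at b' p Z' ->
  exists2 u, E p *: Z' = Z + u *: d_dt &
    forall W, u * 'D_d_dt (b ^~ W) p = 'D_(W.1) phi p.1 - b p W * 'D_(Z.1) phi p.1.
Proof.
move=> Up D0 rZ rZ'; have b'U := semibasic_conformal.
have Ep : E p != 0 by rewrite gt_eqF// expR_gt0.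
have Z1 : E p *: Z'.1 = Z.1.
  have [e0 e1] := reeb_at_coord bU Up rZ.
  have [] := reeb_at_coord b'U Up rZ'.
  rewrite contact_coef_conformal// !derive_conformal// !derive0.
  rewrite !mulr0 !addr0 => e0' e1'.
  apply/rowP => k; rewrite mxE; apply: (mulIf D0); apply: (mulfI Ep).
  case: k => -[|[|//]] ?.
    rewrite (_ : Ordinal _ = 0); last exact/val_inj.
    by rewrite e0 mulrN -e0'; ring.
  rewrite (_ : Ordinal _ = 1); last exact/val_inj.
  by rewrite e1 -e1'; ring.
have EZ' : E p *: Z' = Z + (E p * Z'.2 - Z.2) *: d_dt.
  rewrite [LHS]surjective_pairing [in RHS](surjective_pairing Z).
  congr pair => /=; first by rewrite scaler0 addr0.
  by rewrite /GRing.scale/= mulr1 addrC subrK.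
exists (E p * Z'.2 - Z.2); first exact: EZ'.
move=> W; have [_ _ dif] := bU Up.
have [+ /(_ W)] := rZ'; have [bZ /(_ W)] := rZ; rewrite /ext_deriv.
rewrite !derive_conformal// b'E// -/(E p).
(* Here [Z] and [Z'] are frozen vectors, and only their base parts matter. *)
have -> : 'D_W (b ^~ Z) p = E p * 'D_W (b ^~ Z') p.
  rewrite (semibasic_derive_sum bU Z) ?(semibasic_derive_sum bU Z')// -Z1.
  by rewrite !mxE mulrDr !mulrA.
have eZ : E p * 'D_Z' (b ^~ W) p =
    'D_Z (b ^~ W) p + (E p * Z'.2 - Z.2) * 'D_d_dt (b ^~ W) p.
  have := derive_dirP (E p) Z' 0 (dif W); rewrite derive0 !addr0 EZ' => /esym e.
  apply: etrans e _.
  by rewrite addrC derive_dirP// addrC.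
have -> : 'D_(Z.1) phi p.1 = E p * 'D_(Z'.1) phi p.1.
  by rewrite -Z1 -[E p *: _]addr0 derive_dirP ?derive0 ?addr0//; exact: dphi.
move: eZ; set u := E p * Z'.2 - Z.2 => eZ e1 e2 e3.
(* With the analytic quantities abstracted, the claim is a linear elimination between the two Reeb
   equations and the normalisation of [Z']. *)
move: eZ e1 e2 e3; move: ('D_Z (b ^~ W) p) ('D_Z' (b ^~ W) p) ('D_W (b ^~ Z') p).
move: ('D_d_dt (b ^~ W) p) ('D_(W.1) phi p.1) ('D_(Z'.1) phi p.1).
move: (b p W) (b p Z') (E p) => bW bZ' e dt w z d1 d2 d3 eZ e1 e3 e2.
have -> : u * dt = e * d2 - d1 by rewrite eZ; ring.
have -> : d1 = e * d3 by apply/eqP; rewrite -subr_eq0 e1.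
have -> : e * d2 = e * (d3 + bZ' * w) - e * (bW * z) by rewrite -[RHS]addr0 -e2; ring.
by transitivity (e * bZ' * w - bW * (e * z)); [ring | rewrite e3 mul1r].
Qed.
End Conformal.
End Semibasic.

(** * Regularity of iterated derivatives of pulled-back functions along a field *)

Section Lie.
Context {R : realType}.
Local Notation hmspace := (@hmspace R).
Implicit Types (U : set 'rV[R]_2) (p q Z W : hmspace).

Definition hcoef (k : 'I_2) Z : R := Z.1 0 k.

Lemma differentiable_hcoef k p : differentiable (hcoef k) p.
Proof.
by apply: (@differentiable_comp_fst _ _ _ _ (fun u : 'rV[R]_2 => u 0 k));
  exact: differentiable_coord.
Qed.

Lemma derive_hcoef (X : hmspace -> hmspace) k p W :
  derivable X p W -> 'D_W (hcoef k \o X) p = hcoef k ('D_W X p).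
Proof.
move=> dX; apply: cvg_lim => //.
rewrite [X in X @ _ --> _](_ : _ =
    hcoef k \o (fun h => h^-1 *: (X (h *: W + p) - X p))).
  apply: continuous_cvg; last exact: dX.
  exact/differentiable_continuous/differentiable_hcoef.
by apply/funext => h /=; rewrite /hcoef !mxE.
Qed.

Lemma derive_hmspace (h : hmspace -> R) p Z : differentiable h p ->
  'D_Z h p = hcoef 0 Z * 'D_(basis_vec 0) h p
           + (hcoef 1 Z * 'D_(basis_vec 1) h p + Z.2 * 'D_d_dt h p).
Proof.
move=> dh; rewrite [in LHS](hmspace_sum Z) !derive_dirP//.
by rewrite -[Z.2 *: d_dt]addr0 derive_dirP// derive0 addr0.
Qed.

Lemma derive_rV2 (g : 'rV[R]_2 -> R) y u : differentiable g y ->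
  'D_u g y = u 0 0 * 'D_(delta_mx 0 0) g y + u 0 1 * 'D_(delta_mx 0 1) g y.
Proof.
move=> dg; rewrite [in LHS](rV2_sum u) derive_dirP//.
by rewrite -[u 0 1 *: _]addr0 derive_dirP// derive0 addr0.
Qed.

Section Field.
Variables (U : set 'rV[R]_2) (X : hmspace -> hmspace) (g : 'rV[R]_2 -> R).
Hypotheses (oU : open U) (sX : smooth_on [set p | U p.1] X) (sg : smooth_on U g).

Local Notation dg k := ('D_(delta_mx 0 k) g).
Local Notation lift_fun g := (fun q : hmspace => g q.1).

Lemma lie_lift p : U p.1 -> lie X (lift_fun g) p =
  hcoef 0 (X p) * dg 0 p.1 + hcoef 1 (X p) * dg 1 p.1.
Proof. by move=> Up; rewrite /lie derive_fst derive_rV2//; exact: (sg [::]). Qed.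

Let dX k p : U p.1 -> differentiable (hcoef k \o X) p.
Proof.
move=> Up; apply: differentiable_comp; first exact: (sX [::]).
exact: differentiable_hcoef.
Qed.

Let ddg k p : U p.1 -> differentiable (lift_fun (dg k)) p.
Proof. by move=> Up; apply: differentiable_comp_fst; exact: (sg [:: _]). Qed.

Let near_lie p : U p.1 -> \forall q \near p,
  ((hcoef 0 \o X) * lift_fun (dg 0) + (hcoef 1 \o X) * lift_fun (dg 1)) q =
  lie X (lift_fun g) q.
Proof. by move=> Up; apply: filterS (near_fst oU Up) => q Uq; rewrite lie_lift. Qed.

Lemma differentiable_lie p : U p.1 -> differentiable (lie X (lift_fun g)) p.
Proof.
move=> Up; apply: near_eq_differentiable (near_lie Up) _.
by apply: differentiableD; apply: differentiableM; by [exact: dX|exact: ddg].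
Qed.

(** Leibniz's rule writes this derivative near [p] through iterated derivatives of [X] and [g] (the
    [G] below); these are differentiable, hence continuous. *)
Lemma continuous_derive_lie W p : U p.1 ->
  {for p, continuous ('D_W (lie X (lift_fun g)))}.
Proof.
move=> Up.
pose G (k : 'I_2) q := (X q).1 0 k * 'D_(W.1) (dg k) q.1 + dg k q.1 * ('D_W X q).1 0 k.
have GE : \forall q \near p, G 0 q + G 1 q = 'D_W (lie X (lift_fun g)) q.
  apply: filterS (near_fst oU Up) => q Uq.
  have dM k : derivable ((hcoef k \o X) * lift_fun (dg k)) q W.
    by apply: derivableM; apply: diff_derivable; [exact: dX|exact: ddg].
  rewrite -(near_eq_derive _ (near_lie Uq)) deriveD// !deriveM;
    try (apply: diff_derivable; by [exact: dX|exact: ddg]).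
  rewrite !derive_hcoef; try (apply: diff_derivable; exact: (sX [::])).
  by rewrite !(@derive_fst _ _ _ (dg _)).
have cX k vs : {for p, continuous (fun q => hcoef k (iter_derive vs X q))}.
  apply: differentiable_continuous.
  by apply: differentiable_comp; [exact: sX|exact: differentiable_hcoef].
have cg vs : {for p, continuous (lift_fun (iter_derive vs g))}.
  by apply/differentiable_continuous/differentiable_comp_fst/sg.
have cG k : {for p, continuous (G k)}.
  apply: cvgD; apply: cvgM; [exact: (cX k [::])|exact: (cg [:: _; _])|
    exact: (cg [:: _])|exact: (cX k [:: W])].
rewrite /prop_for /continuous_at -(nbhs_singleton GE).
apply: cvg_trans (cvgD (cG 0) (cG 1)); apply: near_eq_cvg; exact: GE.
Qed.

(** The direction [X q] of the outer derivative varies with [q], so it is expanded over three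
    constant directions, to which [continuous_derive_lie] applies. *)
Lemma continuous_lie_lie p : U p.1 ->
  {for p, continuous (lie X (lie X (lift_fun g)))}.
Proof.
move=> Up.
have cX k : {for p, continuous (fun q => hcoef k (X q))}.
  apply: differentiable_continuous; exact: dX.
have cX2 : {for p, continuous (fun q => (X q).2)}.
  apply: continuous_comp; last exact: cvg_snd.
  by apply: differentiable_continuous; exact: (sX [::]).
pose l := lie X (lift_fun g).
pose G q := hcoef 0 (X q) * 'D_(basis_vec 0) l q
           + (hcoef 1 (X q) * 'D_(basis_vec 1) l q + (X q).2 * 'D_d_dt l q).
have GE : \forall q \near p, G q = lie X l q.
  apply: filterS (near_fst oU Up) => q Uq.
  by rewrite /lie derive_hmspace//; exact: differentiable_lie.
have cG : {for p, continuous G}.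
  apply: cvgD; [|apply: cvgD]; apply: cvgM;
    by [exact: cX|exact: cX2|exact: continuous_derive_lie].
rewrite /prop_for /continuous_at -(nbhs_singleton GE).
apply: cvg_trans cG; apply: near_eq_cvg; exact: GE.
Qed.
End Field.
End Lie.

(** * Second Reeb derivative under a conformal change *)

Section LieConformal.
Context {R : realType}.
Local Notation hmspace := (@hmspace R).
Variables (U : set 'rV[R]_2) (b b' : hmspace -> hmspace -> R).
Variables (phi g : 'rV[R]_2 -> R) (X X' : hmspace -> hmspace).
Hypotheses (oU : open U) (bU : semibasic U b) (sphi : smooth_on U phi).
Hypotheses (sX : smooth_on [set p | U p.1] X) (sg : smooth_on U g).
Hypothesis b'E : forall p Z, U p.1 -> b' p Z = expR (phi p.1) * b p Z.
Hypothesis contact : forall p, U p.1 -> contact_coef b p != 0.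
Hypothesis rX : forall p, U p.1 -> reeb_at b p (X p).
Hypothesis rX' : forall p, U p.1 -> reeb_at b' p (X' p).

Local Notation lift_fun g := (fun q : hmspace => g q.1).
Local Notation h := (lie X (lift_fun g)).

(** The coefficient of [dphi /\ b] on the two base directions, times the first Reeb derivative of
    [g]. *)
Definition fibre_primitive (q : hmspace) : R :=
  ('D_(delta_mx 0 0) phi q.1 * b q (basis_vec 1)
   - 'D_(delta_mx 0 1) phi q.1 * b q (basis_vec 0)) * h q.

Let dphi y : U y -> differentiable phi y. Proof. exact: (sphi [::]). Qed.

Let dE p : U p.1 -> differentiable (fun q : hmspace => expR (- phi q.1)) p.
Proof.
move=> Up; apply: (@differentiable_comp_fst _ _ _ _ (fun y => expR (- phi y))).
by apply/differentiable_expR/differentiableN/dphi.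
Qed.

Lemma reeb_conformal_scale p : U p.1 -> exists2 u,
  X' p = expR (- phi p.1) *: (X p + u *: d_dt) &
  forall W, u * 'D_d_dt (b ^~ W) p =
    'D_(W.1) phi p.1 - b p W * 'D_((X p).1) phi p.1.
Proof.
move=> Up; have [u e uE] :=
  reeb_conformal oU bU dphi b'E Up (contact Up) (rX Up) (rX' Up).
by exists u => //; rewrite -e scalerA -expRD addNr expR0 scale1r.
Qed.

(** A pulled-back function only sees base components, so the vertical part of [X'] drops out at
    first order. *)
Lemma lie_conformal p : U p.1 ->
  lie X' (lift_fun g) p = expR (- phi p.1) * h p.
Proof.
move=> Up; have [u XE _] := reeb_conformal_scale Up.
rewrite !(lie_lift _ sg Up) XE /hcoef /=.
by rewrite scaler0 addr0 !mxE; ring.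
Qed.

Lemma derive_fibre_primitive p : U p.1 -> 'D_d_dt fibre_primitive p =
  ('D_(delta_mx 0 0) phi p.1 * 'D_d_dt (b ^~ (basis_vec 1)) p
   - 'D_(delta_mx 0 1) phi p.1 * 'D_d_dt (b ^~ (basis_vec 0)) p) * h p
  + ('D_(delta_mx 0 0) phi p.1 * b p (basis_vec 1)
   - 'D_(delta_mx 0 1) phi p.1 * b p (basis_vec 0)) * 'D_d_dt h p.
Proof.
move=> Up; have [_ _ db] := bU Up.
have dh : derivable h p d_dt by exact/diff_derivable/(differentiable_lie oU sX sg Up).
have dpsi k : derivable (lift_fun ('D_(delta_mx 0 k) phi)) p d_dt.
  apply/diff_derivable/(@differentiable_comp_fst _ _ _ _ ('D__ phi)).
  exact: (sphi [:: _]).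
have dbk k : derivable (b ^~ (basis_vec k)) p d_dt by exact: diff_derivable.
have psi0 k : 'D_d_dt (lift_fun ('D_(delta_mx 0 k) phi)) p = 0.
  by rewrite (@derive_fst _ _ _ ('D__ phi)) derive0.
pose A k l : hmspace -> R := lift_fun ('D_(delta_mx 0 k) phi) * (b ^~ (basis_vec l)).
have dA k l : derivable (A k l) p d_dt := derivableM (dpsi k) (dbk l).
have DA k l : 'D_d_dt (A k l) p =
    'D_(delta_mx 0 k) phi p.1 * 'D_d_dt (b ^~ (basis_vec l)) p.
  by rewrite /A (deriveM (dpsi k) (dbk l)) psi0 scaler0 addr0.
have -> : fibre_primitive = (A 0 1 - A 1 0) * h by [].
rewrite (deriveM (derivableB (dA 0 1) (dA 1 0)) dh) (deriveB (dA 0 1) (dA 1 0)) !DA.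
by rewrite addrC; congr (_ + _); exact: mulrC.
Qed.

(** At second order both the vertical part of [X'] and the derivative of the factor contribute.
    Multiplying by [contact_coef] eliminates [u] without dividing. *)
Lemma lie_lie_conformal p : U p.1 ->
  contact_coef b p * lie X' (lie X' (lift_fun g)) p =
  expR (- phi p.1) ^+ 2 *
    (contact_coef b p * lie X h p + 'D_d_dt fibre_primitive p).
Proof.
move=> Up; have [u XE uE] := reeb_conformal_scale Up.
have dh := differentiable_lie oU sX sg Up.
have [_ _ db] := bU Up.
have -> : lie X' (lie X' (lift_fun g)) p =
    'D_(X' p) (fun q => expR (- phi q.1) * h q) p.
  by apply: near_eq_derive; apply: filterS (near_fst oU Up) => q; exact: lie_conformal.
rewrite (@deriveM _ _ (fun q => expR (- phi q.1)) h);
  [|exact/diff_derivable/dE|exact/diff_derivable].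
rewrite (@derive_fst _ _ _ (fun y => expR (- phi y))).
rewrite (@derive_expR_comp _ _ (fun y => - phi y)); last exact/differentiableN/dphi.
have -> v : 'D_v (fun y => - phi y) p.1 = - 'D_v phi p.1.
  by apply: deriveN; exact/diff_derivable/dphi.
have -> : 'D_(X' p) h p =
    expR (- phi p.1) * (lie X h p + u * 'D_d_dt h p).
  rewrite XE -[_ *: (X p + _)]addr0 derive_dirP// derive0 addr0.
  by rewrite [X p + _]addrC derive_dirP// addrC.
have -> : 'D_((X' p).1) phi p.1 = expR (- phi p.1) * 'D_((X p).1) phi p.1.
  rewrite XE /= scaler0 addr0 -[_ *: _]addr0.
  by rewrite derive_dirP ?derive0 ?addr0//; exact: dphi.
rewrite derive_fibre_primitive// /contact_coef.
(* Here [c] is the derivative of [phi] along [X]. With [D = b1 * d0 - b0 * d1], the two equations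
   for [u] give [D * u = f0 * b1 - f1 * b0] and [D * c = f1 * d0 - f0 * d1], so
   [D * (u * ht - c * hp)] is the derivative of the primitive. *)
have algebra (L ht hp c f1 f0 e d1 d0 b1 b0 : R) :
    u * d0 = f0 - b0 * c -> u * d1 = f1 - b1 * c ->
    (b1 * d0 - b0 * d1) * (e * (e * (L + u * ht)) + hp * (e * - (e * c))) =
    e ^+ 2 * ((b1 * d0 - b0 * d1) * L +
      ((f0 * d1 - f1 * d0) * hp + (f0 * b1 - f1 * b0) * ht)).
  move=> /eqP; rewrite eq_sym subr_eq => /eqP -> /eqP; rewrite eq_sym subr_eq => /eqP ->.
  by ring.
exact: algebra (uE (basis_vec 0)) (uE (basis_vec 1)).
Qed.
End LieConformal.

(** * One-variable calculus on a fibre *)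

Section Fibre.
Context {R : realType}.
Local Notation hmspace := (@hmspace R).
Local Notation mu := (@lebesgue_measure R).

(** Two values of opposite sign would force a zero by the intermediate value theorem. This trades
    the absolute value in the fibre integral for a constant sign. *)
Lemma continuous_sg (m : R -> R) : continuous m -> (forall t, m t != 0) ->
  forall t, `|m t| = Num.sg (m 0) * m t.
Proof.
move=> cm m0 t; rewrite [LHS]normrEsg; congr (_ * _).
have same a b : a <= b -> Num.sg (m a) = Num.sg (m b).
  move=> ab; have := m0 a; have := m0 b; rewrite !neq_lt.
  have ivt : ~ (Num.min (m a) (m b) <= 0 <= Num.max (m a) (m b)).
    move=> h; have [|c _ /eqP] := IVT ab _ h; last by rewrite (negbTE (m0 c)).
    exact: continuous_subspaceT.
  move=> /orP[mb|mb] /orP[ma|ma].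
  - by rewrite !ltr0_sg.
  - by case: ivt; rewrite ge_min le_max (ltW mb) (ltW ma) orbT.
  - by case: ivt; rewrite ge_min le_max (ltW mb) (ltW ma) orbT.
  - by rewrite !gtr0_sg.
by have [t0|/ltW t0] := leP t 0; [rewrite (same t 0)|rewrite (same 0 t)].
Qed.

Lemma integrable_segment (f : R -> R) (a b : R) : continuous f ->
  mu.-integrable `[a, b] (EFin \o f).
Proof.
move=> cf; apply: continuous_compact_integrable; first exact: segment_compact.
exact: continuous_subspaceT.
Qed.

Lemma Rintegral_derive (F : R -> R) (a b : R) : a < b ->
  (forall t, derivable F t 1) -> continuous ('D_1 F) ->
  \int[mu]_(t in `[a, b]) 'D_1 F t = F b - F a.
Proof.
move=> ab dF cF; rewrite /Rintegral (@continuous_FTC2 _ _ F)//.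
- exact: continuous_subspaceT.
- have cont t : {for t, continuous F}.
    by apply: differentiable_continuous; apply/derivable1_diffP.
  split => //; first exact: cvg_at_right_filter (cont a).
  exact: cvg_at_left_filter (cont b).
- by move=> t _; rewrite derive1E.
Qed.

Let fibre_quotient (G : hmspace -> R) y t :
  (fun h : R => h^-1 *: (G (h *: d_dt + (y, t)) - G (y, t))) =
  (fun h : R => h^-1 *: (G (y, h *: 1 + t) - G (y, t))).
Proof. apply/funext => h; congr (_ *: (G _ - _)).
by rewrite -[in RHS](add0r y) -(scaler0 _ h). Qed.

Lemma derive_fibre (G : hmspace -> R) y t :
  'D_1 (fun s => G (y, s)) t = 'D_d_dt G (y, t).
Proof. by rewrite /derive /= fibre_quotient. Qed.

Lemma derivable_fibre (G : hmspace -> R) y t :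
  differentiable G (y, t) -> derivable (fun s => G (y, s)) t 1.
Proof.
by move=> /(@diff_derivable _ _ _ _ _ d_dt); rewrite /derivable fibre_quotient.
Qed.

Lemma continuous_fibre (T : topologicalType) (G : hmspace -> T) y :
  (forall t, {for (y, t), continuous G}) -> continuous (fun t => G (y, t)).
Proof.
move=> cG t; apply: (@continuous_comp _ _ _ (fun s => (y, s))); last exact: cG.
apply: (@cvg_pair _ _ _ (nbhs t) (nbhs y) (nbhs t) _ _ _ (cst y) id).
  exact: cvg_cst.
exact: cvg_id.
Qed.
End Fibre.

(** * Fibre integral under a conformal change *)

Section FibreIntegral.
Context {R : realType}.
Local Notation hmspace := (@hmspace R).
Local Notation mu := (@lebesgue_measure R).
Variables (U : set 'rV[R]_2) (b b' : hmspace -> hmspace -> R).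
Variables (phi g : 'rV[R]_2 -> R) (X X' : hmspace -> hmspace).
Hypotheses (oU : open U) (bU : semibasic U b) (sphi : smooth_on U phi).
Hypotheses (sX : smooth_on [set p | U p.1] X) (sX' : smooth_on [set p | U p.1] X').
Hypothesis sg : smooth_on U g.
Hypothesis b'E : forall p Z, U p.1 -> b' p Z = expR (phi p.1) * b p Z.
Hypothesis contact : forall p, U p.1 -> contact_coef b p != 0.
Hypothesis rX : forall p, U p.1 -> reeb_at b p (X p).
Hypothesis rX' : forall p, U p.1 -> reeb_at b' p (X' p).
Variables (y : 'rV[R]_2) (m m' : R -> R) (w w' c : R).
Hypothesis Uy : U y.
Hypothesis bT : forall Z, b (y, 2 * pi) Z = b (y, 0) Z.
Hypothesis XT : X (y, 2 * pi) = X (y, 0).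
Hypotheses (cm : continuous m) (m0 : forall t, m t != 0) (w0 : w != 0) (w'0 : w' != 0).
Hypothesis mE : forall t, m t * w = contact_coef b (y, t).
Hypothesis m'E : forall t, m' t * w' = contact_coef b' (y, t).
Hypothesis c0 : c != 0.
Hypothesis m_vol : \int[mu]_(t in `[0, 2 * pi]) `|m t| = c.
Hypothesis m'_vol : \int[mu]_(t in `[0, 2 * pi]) `|m' t| = c.

Local Notation lift_fun g := (fun q : hmspace => g q.1).
Local Notation L := (lie X (lie X (lift_fun g))).
Local Notation L' := (lie X' (lie X' (lift_fun g))).
Local Notation G := (fibre_primitive b phi g X).

Let two_pi_gt0 : 0 < 2 * pi :> R. Proof. by rewrite mulr_gt0// pi_gt0. Qed.

Let dphi z : U z -> differentiable phi z. Proof. exact: (sphi [::]). Qed.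

Let continuous_norm_m : continuous (fun t => `|m t|).
Proof. by move=> t; apply: cvg_norm; exact: cm. Qed.

(** In the application [m], [m'] are the angle forms on [d_dt] and [w], [w'] the volume densities at
    [y]. The ratio of [|m'|] to [|m|] is constant along the fibre, and the common total [c] forces
    it to be 1. *)
Lemma conformal_angle t : `|m' t| = `|m t|.
Proof.
(* Ratio read off from [m' * w' = expR (phi y) ^+ 2 * (m * w)]. *)
pose k := expR (phi y) ^+ 2 * `|w| / `|w'|.
have m'k s : `|m' s| = k * `|m s|.
  have nw' : `|w'| != 0 by rewrite normr_eq0.
  apply: (mulIf nw'); rewrite -normrM m'E.
  rewrite (contact_coef_conformal oU bU dphi b'E)// -mE [LHS]normrM (normrM (m s)).
  rewrite (ger0_norm (exprn_ge0 _ (expR_ge0 _))) /k /=.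
  by field.
suff k1 : k = 1 by rewrite m'k k1 mul1r.
apply: (mulIf c0); rewrite mul1r -[RHS]m'_vol -m_vol.
rewrite -RintegralZl//; first by apply: eq_Rintegral => s _; rewrite m'k.
exact: integrable_segment.
Qed.

Let differentiable_G p : U p.1 -> differentiable G p.
Proof.
move=> Up; have [_ _ db] := bU Up.
have d k l : differentiable
    (fun q => 'D_(delta_mx 0 k) phi q.1 * b q (basis_vec l)) p.
  apply: (@differentiableM _ _ (lift_fun ('D__ phi)) (b ^~ _)) => //.
  apply: (@differentiable_comp_fst _ _ _ _ ('D__ phi)); exact: (sphi [:: _]).
apply: differentiableM; last exact: (differentiable_lie oU sX sg Up).
exact: differentiableB.
Qed.

Let continuous_L t : {for t, continuous (fun s => L (y, s))}.
Proof. by apply: continuous_fibre => s; exact: (continuous_lie_lie (U := U)). Qed.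

Let derive_G t : 'D_1 (fun s => G (y, s)) t =
  w * m t * (expR (phi y) ^+ 2 * L' (y, t)) - w * m t * L (y, t).
Proof.
have e0 : expR (phi y) ^+ 2 * expR (- phi y) ^+ 2 = 1.
  by rewrite -exprMn -expRD addrN expR0 expr1n.
rewrite derive_fibre.
have := lie_lie_conformal oU bU sphi sX sg b'E contact rX rX' (p := (y, t)) Uy.
rewrite -mE /=; move: e0 ('D_d_dt _ _) (L' _) (L _) => e0 D l' l e.
transitivity (expR (phi y) ^+ 2 * (m t * w * l') - m t * w * l); last by ring.
by rewrite e mulrA e0 mul1r [RHS]addrC addKr.
Qed.

Let continuous_derive_G : continuous ('D_1 (fun s => G (y, s))).
Proof.
have -> : 'D_1 (fun s => G (y, s)) = fun t =>
  w * m t * (expR (phi y) ^+ 2 * L' (y, t)) - w * m t * L (y, t).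
  by apply/funext => t; exact: derive_G.
move=> t; have cwm : {for t, continuous (fun t => w * m t)}.
  by apply: cvgM; [exact: cvg_cst|exact: cm].
apply: cvgB; apply: cvgM => //; last exact: continuous_L.
apply: cvgM; first exact: cvg_cst.
by apply: continuous_fibre => s; exact: (continuous_lie_lie (U := U)).
Qed.

(** Periodicity: [b] and [X] take the same values at t = 0 and t = 2 pi, hence so does the
    primitive. *)
Lemma Rintegral_derive_fibre_primitive :
  \int[mu]_(t in `[0, 2 * pi]) 'D_1 (fun s => G (y, s)) t = 0.
Proof.
rewrite (@Rintegral_derive _ (fun s => G (y, s)))//; last first.
  by move=> t; apply: derivable_fibre; exact: differentiable_G.
by rewrite /fibre_primitive !bT !(lie_lift _ sg)//= XT subrr.
Qed.

Lemma fibre_lie_lie_conformal :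
  \int[mu]_(t in `[0, 2 * pi]) (L' (y, t) * `|m' t|) =
  expR (- phi y) ^+ 2 * \int[mu]_(t in `[0, 2 * pi]) (L (y, t) * `|m t|).
Proof.
pose s := Num.sg (m 0).
(* The factor [s / w] comes from [|m t| = s * m t] and [contact_coef = m t * w]: times the
   derivative of the primitive, it gives [|m t| * (expR (phi y) ^+ 2 * L' - L)]. *)
have E t : L' (y, t) * `|m' t| = expR (- phi y) ^+ 2 * (L (y, t) * `|m t|
    + s / w * 'D_1 (fun s => G (y, s)) t).
  have e0 : expR (- phi y) ^+ 2 * expR (phi y) ^+ 2 = 1.
    by rewrite -exprMn -expRD addNr expR0 expr1n.
  rewrite conformal_angle (continuous_sg cm m0) -/s derive_G.
  move: (expR (- phi y) ^+ 2) (expR (phi y) ^+ 2) e0 (L' _) (L _) (m t) s.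
  move=> e e' e0 l' l n s; rewrite -[l' in LHS]mul1r -e0.
  by field.
under eq_Rintegral do rewrite E.
have cL : continuous (fun t => L (y, t) * `|m t|).
  by move=> t; apply: cvgM; [exact: continuous_L|exact: continuous_norm_m].
have cG : continuous (fun t => s / w * 'D_1 (fun s => G (y, s)) t).
  by move=> t; apply: cvgM; [exact: cvg_cst|exact: continuous_derive_G].
rewrite RintegralZl//; last first.
  by apply: integrable_segment => t; apply: cvgD; [exact: cL|exact: cG].
congr (_ * _); rewrite RintegralD//; [|exact: integrable_segment..].
rewrite RintegralZl//; last exact: integrable_segment.
by rewrite Rintegral_derive_fibre_primitive mulr0 addr0.
Qed.
End FibreIntegral.

(** * The Hilbert form of a Finsler metric in coordinates *)

Section HilbertForm.
Context {R : realType} {M : surface R}.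
Implicit Types (F : forall x : M, tangent M x -> R) (i : chart_index M).

Lemma dirE (t : R) : dir t = cos t *: delta_mx 0 0 + sin t *: delta_mx 0 1.
Proof. by rewrite [LHS]rV2_sum !mxE. Qed.

Lemma dir_neq0 (t : R) : dir t != 0.
Proof.
apply/eqP => /rowP d0; have := cos2Dsin2 t.
move: (d0 0) (d0 1); rewrite !mxE /= => -> ->.
by rewrite expr0n addr0 => /esym/eqP; rewrite oner_eq0.
Qed.

Lemma dir_periodic (t : R) : dir (t + 2 * pi) = dir t.
Proof. by rewrite !dirE mulr_natl sinD2pi cosD2pi. Qed.

Lemma differentiable_dir (t : R) : differentiable (@dir R) t.
Proof.
have -> : @dir R = (fun t => cos t *: delta_mx 0 0) + (fun t => sin t *: delta_mx 0 1).
  by apply/funext => s; rewrite dirE.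
by apply: differentiableD; apply: differentiableZl; apply/derivable1_diffP.
Qed.

Section Finsler.
Variables (F : forall x : M, tangent M x -> R) (hF : finsler_metric F).
Variable i : chart_index M.

Let Phi (q : 'rV[R]_2 * 'rV[R]_2) : R := finsler_chart F i q.1 q.2.

Let differentiable_finsler_chart y v : img i y -> v != 0 ->
  differentiable (finsler_chart F i y) v.
Proof.
move=> iy v0; apply: (@differentiable_comp _ _ _ _ (fun u => (y, u)) Phi).
  by apply: differentiable_pair.
exact: (finsler_smooth hF (i := i) [::]).
Qed.

Lemma semibasic_hilbert_form : semibasic (img i) (hilbert_form F i).
Proof.
move=> p ip; have d0 := dir_neq0 p.2; split.
- move=> k Z W; rewrite /hilbert_form derive_dirP//.
  exact: differentiable_finsler_chart.
- by move=> Z Z0; rewrite /hilbert_form Z0 derive0.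
- move=> Z; rewrite /hilbert_form.
  (* [F] is smooth jointly in point and vector off the zero section; rewriting the fibre derivative
     as one of [Phi] lets this apply at [dir p.2]. *)
  have -> : (fun q : hmspace => 'D_(Z.1) (finsler_chart F i q.1) (dir q.2)) =
      'D_(0, Z.1) Phi \o (fun q : hmspace => (q.1, dir q.2)).
    by apply/funext => q; rewrite derive_snd.
  apply: differentiable_comp; last exact: (finsler_smooth hF (i := i) [:: _]).
  apply: differentiable_pair; first exact: differentiable_fst.
  apply: (@differentiable_comp _ _ _ _ snd (@dir R)); last exact: differentiable_dir.
  by apply: linear_differentiable => q; exact: cvg_snd.
Qed.

(** The conformal factor is constant on each tangent space, so it comes out of the fibre
    derivative. *)
Lemma hilbert_form_conformal (f : M -> R) p Z : img i p.1 ->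
  hilbert_form (conformal f F) i p Z =
  expR ((f \o chart_inv i) p.1) * hilbert_form F i p Z.
Proof.
move=> ip; rewrite /hilbert_form.
have -> : finsler_chart (conformal f F) i p.1 =
    expR (f (chart_inv i p.1)) \*: finsler_chart F i p.1 by [].
rewrite deriveZ//; apply/diff_derivable/differentiable_finsler_chart => //.
exact: dir_neq0.
Qed.
End Finsler.

Lemma hilbert_form_periodic F i y t Z :
  hilbert_form F i (y, t + 2 * pi) Z = hilbert_form F i (y, t) Z.
Proof. by rewrite /hilbert_form /= dir_periodic. Qed.

(** The shift of t by 2 pi fixes every ray, so it is a coordinate change from [i] to itself; its
    differential is the identity, and the transformation law of [X] gives the equality. *)
Lemma hm_vector_field_periodic (X : chart_index M -> hmspace -> hmspace) i y t :
  hm_vector_field X -> img i y -> X i (y, t + 2 * pi) = X i (y, t).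
Proof.
move=> [_ XT] iy; pose T (p : @hmspace R) : hmspace := p + (0, 2 * pi).
have dT p : is_diff p T id.
  rewrite -[id](addr0 (id : hmspace -> hmspace)).
  exact: is_diffD.
have TE p : T p = (p.1, p.2 + 2 * pi).
  by rewrite [p in LHS]surjective_pairing; congr pair; rewrite /= addr0.
have -> : (y, t + 2 * pi) = T (y, t) by rewrite TE.
rewrite (XT i i T (y, t)) ?diff_val//; split => //.
apply: (@filterS _ _ (nbhs_filter ((y, t) : hmspace)) setT _ _ filterT).
move=> q _ z [dz cz rz]; split => //.
- by rewrite TE.
- by rewrite TE /= dir_periodic.
Qed.

(** Evaluate the defining identity on [d_dt], [basis_vec 0], [basis_vec 1]: the area form vanishes
    once [d_dt] is one of its arguments, leaving one term. *)
Lemma angle_volume_contact F i (alpha : chart_index M -> hmspace -> hmspace -> R)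
    omega p : angle_volume F alpha omega -> semibasic (img i) (hilbert_form F i) ->
  img i p.1 -> alpha i p d_dt * omega i p.1 = contact_coef (hilbert_form F i) p.
Proof.
move=> [_ _ _ av _] sb ip.
rewrite -(wedge12_ext_deriv (@chart_open _ M i) sb ip) -av//.
rewrite /wedge12 /area /= !mxE /=.
by rewrite !(mul0r, mulr0, mulr1, subr0, addr0).
Qed.
End HilbertForm.

(** * Conformal covariance of the Laplacian, read in a chart around a point *)

Theorem theorem2 (R : realType) (Sigma : surface R) (hSigma : orientable Sigma)
    (F : forall x : Sigma, tangent Sigma x -> R) (hF : finsler_metric F)
    (f : Sigma -> R) (hf : smooth f)
    (DF DFf : (Sigma -> R) -> Sigma -> R)
    (hDF : finsler_laplacian F DF)
    (hDFf : finsler_laplacian (conformal f F) DFf) :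
  forall g : Sigma -> R, smooth g ->
  forall x : Sigma, DFf g x = expR (- (2 * f x)) * DF g x.
Proof.
move=> g sg x; have [i ix] := dom_cover x.
have [X [alpha [omega [rX av DFE]]]] := hDF.
have [X' [alpha' [omega' [rX' av' DFfE]]]] := hDFf.
rewrite (DFE g sg i x ix) (DFfE g sg i x ix).
have iy : img i (chart i x) by exists x.
have oU := @chart_open _ Sigma i.
have sb := semibasic_hilbert_form hF (i := i).
have bE (p Z : @hmspace R) : img i p.1 -> hilbert_form (conformal f F) i p Z =
    expR ((f \o chart_inv i) p.1) * hilbert_form F i p Z.
  exact: hilbert_form_conformal.
have sb' : semibasic (img i) (hilbert_form (conformal f F) i).
  apply: (semibasic_conformal (phi := f \o chart_inv i) oU sb _ bE) => y.
  exact: (hf i [::]).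
have [[vo0 vo1 _] [_ sa _] an _ vol] := av; have [[_ vo1' _] _ _ _ vol'] := av'.
have an0 p : img i p.1 -> alpha i p d_dt != 0.
  by move=> ip; apply: an => //; apply/eqP => -[] /eqP; rewrite oner_eq0.
have ac p ip := angle_volume_contact (p := p) av sb ip.
have ac' p ip := angle_volume_contact (p := p) av' sb' ip.
have fE : (f \o chart_inv i) (chart i x) = f x by rewrite /= chartK.
rewrite mulrCA; congr (_ * _).
have -> : expR (- (2 * f x)) = expR (- (f \o chart_inv i) (chart i x)) ^+ 2.
  by rewrite fE -expRM_natl mulrN.
have v0 : vol_S1 != 0 :> R by rewrite /vol_S1 mulf_neq0// gt_eqF// pi_gt0.
have volE a : fibre_integral (fun=> 1) a (chart i x) = vol_S1 ->
    \int[lebesgue_measure]_(t in `[0, 2 * pi]) `|a (chart i x, t) d_dt| = vol_S1 :> R.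
  by move=> <-; apply: eq_Rintegral => t _; rewrite mul1r.
apply: (@fibre_lie_lie_conformal _ (img i) (hilbert_form F i)
  (hilbert_form (conformal f F) i) (f \o chart_inv i) (g \o chart_inv i)
  (X i) (X' i) oU sb (hf i) (rX.1.1 i) (rX'.1.1 i) (sg i) bE _
  (rX.2 i) (rX'.2 i) (chart i x)
  (fun t => alpha i (chart i x, t) d_dt) (fun t => alpha' i (chart i x, t) d_dt)
  (omega i (chart i x)) (omega' i (chart i x)) vol_S1 iy
  _ _ _ _ (vo1 _ _ iy) (vo1' _ _ iy) _ _ v0 (volE _ (vol _ _ iy))
  (volE _ (vol' _ _ iy))).
(* The contact condition is read off from the angle form: [contact_coef] is the product of
   [alpha(d/dt)] and [omega], both nonzero. *)
- by move=> p ip; rewrite -ac// mulf_neq0// ?an0// vo1.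
- by move=> Z; rewrite -[2 * pi]add0r hilbert_form_periodic.
- by rewrite -[2 * pi]add0r (hm_vector_field_periodic _ rX.1 iy).
- apply: (continuous_fibre (G := fun p => alpha i p d_dt)) => t.
  by apply: differentiable_continuous; exact: (sa i d_dt [::]).
- by move=> t; exact: an0.
- by move=> t; exact: ac.
- by move=> t; exact: ac'.
Qed.
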